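(* Let $p$ be an odd prime, $q\in\mathbb{C}_p$ with $q\neq 1$ and $|q-1|_p<p^{-1/(p-1)}$, $\lambda\in\mathbb{C}_p$ with $\lambda\ne 0$, and $x\in\mathbb{C}_p$ with $|x|_p\le 1$. For every integer $n\ge 0$, $$E_{n,q}(x|\lambda)=\sum_{k=0}^n\sum_{l=0}^k\binom{n}{k}\left([x]_q\right)_{n-k,\lambda}\lambda^{k-l}q^{lx}S_1(k,l)E_{l,q}.$$
   Context: $\mathbb{Z}_p$ is the ring of $p$-adic integers and $\mathbb{C}_p$ the completion of the algebraic closure of $\mathbb{Q}_p$, with $|p|_p=1/p$. For $|z|_p\le 1$, $q^z=\exp(z\log q)$ and $[z]_q=\frac{1-q^z}{1-q}$; also $[N]_{-q}=\frac{1-(-q)^N}{1+q}$ for integers $N\ge 0$. The fermionic $p$-adic $q$-integral of a continuous function $f:\mathbb{Z}_p\to\mathbb{C}_p$ is $$\int_{\mathbb{Z}_p}f(y)\,d\mu_{-q}(y)=\lim_{N\to\infty}\frac{1}{[p^N]_{-q}}\sum_{y=0}^{p^N-1}f(y)(-q)^y .$$ Carlitz's type $q$-Euler numbers $E_{n,q}$ are defined by $E_{0,q}=1$ and $q(qE_q+1)^n+E_{n,q}=0$ for $n\ge1$, where after binomial expansion $E_q^k$ is replaced by $E_{k,q}$; equivalently $E_{n,q}=\int_{\mathbb{Z}_p}[y]_q^n\,d\mu_{-q}(y)$. The degenerate $q$-Euler polynomials $E_{n,q}(x|\lambda)$ are defined by the generating function $$\int_{\mathbb{Z}_p}(1+\lambda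 t)^{\frac{1}{\lambda}[x+y]_q}\,d\mu_{-q}(y)=\sum_{n=0}^\infty E_{n,q}(x|\lambda)\frac{t^n}{n!},$$ where $(1+\lambda t)^{z/\lambda}=\exp\left(\frac{z}{\lambda}\log(1+\lambda t)\right)$ is expanded as a power series in $t$ and the integral is taken coefficientwise. The degenerate falling factorial is $(z)_{n,\lambda}=z(z-\lambda)(z-2\lambda)\cdots(z-(n-1)\lambda)$, with $(z)_{0,\lambda}=1$. $S_1(k,l)$ is the signed Stirling number of the first kind: $X(X-1)\cdots(X-k+1)=\sum_{l=0}^k S_1(k,l)X^l$. *)

(* Defs.v *)
From HB Require Import structures.
From mathcomp Require Import all_boot all_order all_algebra.
From mathcomp Require Import all_classical all_reals all_analysis.
Import Order.TTheory GRing.Theory Num.Theory.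
Import numFieldNormedType.Exports.

Set Implicit Arguments.
Unset Strict Implicit.
Unset Printing Implicit Defensive.

Local Open Scope classical_set_scope.
Local Open Scope ring_scope.

(* Fields with a non-archimedean absolute value with values in R.  This is not
   built on the library norm `| _ |: in the hierarchy a field carrying that
   norm is a numFieldType, ordered and normed by itself. *)
HB.mixin Record Field_hasUltrametric (R : realType) K of GRing.Field K := {
  absv : K -> R ;
  absv_ge0 : forall x : K, 0 <= absv x ;
  absv0_eq0 : forall x : K, absv x = 0 <-> x = 0 ;
  absvM : forall x y : K, absv (x * y) = absv x * absv y ;
  absv_ultra : forall x y : K, absv (x + y) <= Num.max (absv x) (absv y)
}.

#[short(type="ultrametricFieldType")]
HB.structure Definition UltrametricField (R : realType) :=
  {K of GRing.Field K & Field_hasUltrametric R K}.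

Section Ultrametric.
Context {R : realType} {K : ultrametricFieldType R}.
Implicit Types (u : nat -> K) (l : K) (A : set K).

Definition ucvg u l : Prop := (fun n => absv (u n - l)) @ \oo --> (0 : R).

(* 0 when u does not converge *)
Definition ulim u : K := xget 0 [set l | ucvg u l].

Definition ucauchy u : Prop :=
  forall e : R, 0 < e ->
    exists N, forall m n, (N <= m)%N -> (N <= n)%N -> absv (u m - u n) < e.

Definition uclosure A : set K :=
  [set x | forall e : R, 0 < e -> exists2 y, A y & absv (x - y) < e].

End Ultrametric.

Section Cp.
Context {R : realType}.
Variables (p : nat) (K : ultrametricFieldType R).

(* When K is complete and |p| = 1/p, the closure of the rationals in K is the
   completion of the rationals for the p-adic absolute value. *)
Definition Qp : set K := uclosure (range (ratr : rat -> K)).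

Definition Qpbar : set K :=
  [set x | exists P : {poly K},
     [/\ P != 0, (forall i, Qp P`_i) & root P x]].

(* K is a completion of an algebraic closure of Q_p; this determines K up to
   isometric isomorphism. *)
Record is_Cp : Prop := IsCp {
  Cp_complete : forall u : nat -> K, ucauchy u -> exists l, ucvg u l ;
  Cp_absv_p : absv (p%:R : K) = p%:R^-1 ;
  Cp_Qpbar_closed : forall P : {poly K}, (1 < size P)%N ->
    (forall i, Qpbar P`_i) -> exists2 x, Qpbar x & root P x ;
  Cp_Qpbar_dense : uclosure Qpbar = setT
}.

End Cp.

Section QAnalogues.
Context {R : realType} {K : ultrametricFieldType R}.
Implicit Types q z : K.

Definition padic_exp z : K := ulim (series (fun n => z ^+ n / n`!%:R)).

Definition padic_log z : K :=
  ulim (series (fun n => (-1) ^+ n * (z - 1) ^+ n.+1 / n.+1%:R)).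

Definition qpow q z : K := padic_exp (z * padic_log q).

Definition qnum q z : K := (1 - qpow q z) / (1 - q).

Definition qnum_neg q (N : nat) : K := (1 - (- q) ^+ N) / (1 + q).

(* For f defined on Z_p, extended in any way to K: only the values of f at
   natural numbers occur. *)
Definition fermionic_integral (p : nat) q (f : K -> K) : K :=
  ulim (fun N : nat => (qnum_neg q (p ^ N))^-1 *
                       \sum_(0 <= y < p ^ N) f y%:R * (- q) ^+ y).

(* Linear extension of 'X^k |-> E k. *)
Definition umbral (E : nat -> K) (P : {poly K}) : K :=
  \sum_(k < size P) P`_k * E k.

Definition carlitz_qEuler q (E : nat -> K) : Prop :=
  E 0%N = 1 /\
  forall n, (1 <= n)%N -> q * umbral E ((q *: 'X + 1) ^+ n) + E n = 0.

End QAnalogues.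

(* Formal power series, as sequences of coefficients. *)
Section FormalSeries.
Context {K : fieldType}.
Implicit Types f g : nat -> K.

Definition fps_mul f g : nat -> K :=
  fun n => \sum_(i < n.+1) f i * g (n - i)%N.

Definition fps_pow f k : nat -> K :=
  iter k (fps_mul f) (fun n => (n == 0%N)%:R).

(* Composition f(g(t)), meaningful when g 0 = 0: then g^k has no coefficient
   of degree smaller than k. *)
Definition fps_comp f g : nat -> K :=
  fun n => \sum_(k < n.+1) f k * fps_pow g k n.

Definition fps_exp : nat -> K := fun n => n`!%:R^-1.

Definition fps_log1p (lambda : K) : nat -> K :=
  fun n => if n is m.+1 then (-1) ^+ m * lambda ^+ n / n%:R else 0.

(* (1 + lambda t) ^ (z / lambda) *)
Definition degenerate_exp (lambda z : K) : nat -> K :=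
  fps_comp fps_exp (fun n => z / lambda * fps_log1p lambda n).

Definition degenerate_ffact (lambda z : K) (n : nat) : K :=
  \prod_(i < n) (z - i%:R * lambda).

End FormalSeries.

Definition stirling1 (k l : nat) : int :=
  (\prod_(i < k) ('X - (i%:R)%:P) : {poly int})`_l.

(* n! times the coefficient of t^n in the coefficientwise integral of
   (1 + lambda t) ^ ([x + y]_q / lambda). *)
Definition degenerate_qEuler {R : realType} {K : ultrametricFieldType R}
    (p : nat) (q lambda : K) (n : nat) (x : K) : K :=
  n`!%:R * fermionic_integral p q
             (fun y => degenerate_exp lambda (qnum q (x + y)) n).

(* Main.v *)
Require Import Defs.
From mathcomp Require Import all_boot all_order all_algebra.
From mathcomp Require Import all_classical all_reals all_analysis.
From mathcomp Require Import ring zify.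
Import Order.TTheory GRing.Theory Num.Theory.
Import numFieldNormedType.Exports.

(* The coefficient of t^n / n! in (1 + lambda t)^(z / lambda) is the degenerate
   falling factorial of z, by the differential equation (1 + lambda t) F' = z F.
   Since [x + y]_q = [x]_q + q^x [y]_q, the Vandermonde identity for falling
   factorials and their expansion in Stirling numbers reduce the theorem to
   the moments of [y]_q, i.e. to lim S_N([y]_q^n) = E_n where S_N is the N-th
   Riemann sum of the fermionic integral.  As p is odd, q S_N(g(y + 1)) + S_N(g)
   telescopes; for g = [y]_q^n with n >= 1 it tends to 0, and
   [y + 1]_q = q [y]_q + 1 makes this Carlitz's recursion.

   That q^y = exp(y log q) is the ordinary power for natural y rests on
   exp(log q) = q, obtained from log q = lim (q^(p^N) - 1) / p^N. *)

Set Implicit Arguments.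
Unset Strict Implicit.
Unset Printing Implicit Defensive.

Local Open Scope ring_scope.

(** * Limits in ultrametric fields *)

Section Ultrametric.
Context {R : realType} {K : ultrametricFieldType R}.
Implicit Types (x y z : K) (u v : nat -> K).

Lemma absv_0 : absv (0 : K) = 0.
Proof. by apply/absv0_eq0. Qed.

Lemma absv_eq0 x : (absv x == 0) = (x == 0).
Proof. by apply/eqP/eqP => /absv0_eq0. Qed.

Lemma absv_gt0 x : (0 < absv x) = (x != 0).
Proof. by rewrite lt_def absv_eq0 absv_ge0 andbT. Qed.

Lemma absv_1 : absv (1 : K) = 1.
Proof.
have n0 : absv (1 : K) != 0 by rewrite absv_eq0 oner_neq0.
by apply: (mulfI n0); rewrite -absvM !mulr1.
Qed.

Lemma absvX x n : absv (x ^+ n) = absv x ^+ n.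
Proof.
by elim: n => [|n IHn]; rewrite ?expr0 ?absv_1 // !exprS absvM IHn.
Qed.

Lemma absvV x : absv x^-1 = (absv x)^-1.
Proof.
have [->|x0] := eqVneq x 0; first by rewrite invr0 absv_0 invr0.
have x0' : absv x != 0 by rewrite absv_eq0.
by apply: (mulfI x0'); rewrite -absvM !divff ?absv_1.
Qed.

Lemma absvN x : absv (- x) = absv x.
Proof.
rewrite -mulN1r absvM.
suff -> : absv (-1 : K) = 1 by rewrite mul1r.
apply/eqP; rewrite -(@pexpr_eq1 _ _ 2) ?absv_ge0 //.
by rewrite -absvX sqrrN expr1n absv_1.
Qed.

Lemma absvB x y : absv (x - y) = absv (y - x).
Proof. by rewrite -absvN opprB. Qed.

Lemma absvD_le x y (e : R) : absv x <= e -> absv y <= e -> absv (x + y) <= e.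
Proof. by move=> hx hy; rewrite (le_trans (absv_ultra _ _)) // ge_max hx. Qed.

Lemma absvB_le x y (e : R) : absv x <= e -> absv y <= e -> absv (x - y) <= e.
Proof. by move=> hx hy; apply: absvD_le; rewrite ?absvN. Qed.

Lemma absvD_lt x y (e : R) : absv x < e -> absv y < e -> absv (x + y) < e.
Proof. by move=> hx hy; rewrite (le_lt_trans (absv_ultra _ _)) // gt_max hx. Qed.

Lemma absv_sum_le (I : Type) (r : seq I) (P : pred I) (F : I -> K) (e : R) :
  0 <= e -> (forall i, P i -> absv (F i) <= e) ->
  absv (\sum_(i <- r | P i) F i) <= e.
Proof.
move=> e0 H; elim/big_ind: _ => //; first by rewrite absv_0.
by move=> x y; exact: absvD_le.
Qed.

(** If the sum were smaller than [x], then [x = (x + y) - y] would be a difference of two elements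
    smaller than [x] itself. *)
Lemma absvDr x y : absv y < absv x -> absv (x + y) = absv x.
Proof.
move=> xy; apply/le_anti/andP; split; first exact/absvD_le/ltW.
rewrite leNgt; apply/negP => H.
have : absv (x + y - y) < absv x by apply: absvD_lt; rewrite ?absvN.
by rewrite addrK ltxx.
Qed.

Lemma absv_nat_le1 n : absv (n%:R : K) <= 1.
Proof.
elim: n => [|n IHn]; first by rewrite absv_0.
by rewrite mulrS absvD_le ?absv_1.
Qed.

Lemma ucvgP u l :
  ucvg u l <-> forall e, 0 < e ->
    exists N, forall n, (N <= n)%N -> absv (u n - l) < e.
Proof.
rewrite /ucvg; split=> [/cvgr0Pnorm_lt H e e0|H].
  have [N _ HN] := H _ e0.
  by exists N => n Nn; have := HN n Nn; rewrite /= ger0_norm ?absv_ge0.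
apply/cvgr0Pnorm_lt => e e0; have [N HN] := H e e0.
by exists N => // n Nn; rewrite /= ger0_norm ?absv_ge0 ?HN.
Qed.

Lemma ucvg_unique u l l' : ucvg u l -> ucvg u l' -> l = l'.
Proof.
move=> /ucvgP ul /ucvgP ul'; apply/eqP; rewrite -subr_eq0 -absv_eq0.
rewrite eq_le absv_ge0 andbT leNgt; apply/negP => e0.
have [N HN] := ul _ e0; have [N' HN'] := ul' _ e0.
have := HN _ (leq_maxl N N'); rewrite absvB => H.
have := absvD_lt H (HN' _ (leq_maxr N N')).
by rewrite addrA subrK ltxx.
Qed.

Lemma ulim_ucvg u l : ucvg u l -> ulim u = l.
Proof. by move=> ul; apply: xget_unique => // l' /ucvg_unique/(_ ul). Qed.

Lemma ucvg_le_eventually u l (w : nat -> R) N :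
  (forall n, (N <= n)%N -> absv (u n - l) <= w n) ->
  (w @ \oo --> (0 : R))%classic ->
  ucvg u l.
Proof.
move=> H wl; apply: (squeeze_cvgr (f := fun=> 0) (h := w)) => //.
  by exists N => // n /= Nn; rewrite absv_ge0 H.
exact: cvg_cst.
Qed.

Lemma ucvg_le u l (w : nat -> R) :
  (forall n, absv (u n - l) <= w n) -> (w @ \oo --> (0 : R))%classic ->
  ucvg u l.
Proof. by move=> H; apply: (@ucvg_le_eventually _ _ _ 0). Qed.

Lemma ucvg_ext u v l : u =1 v -> ucvg u l -> ucvg v l.
Proof. by move=> /funext ->. Qed.

Lemma ucvg_cst (l : K) : ucvg (fun=> l) l.
Proof. by apply/ucvgP => e e0; exists 0%N => n _; rewrite subrr absv_0. Qed.

Lemma ucvgD u v l m : ucvg u l -> ucvg v m -> ucvg (fun n => u n + v n) (l + m).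
Proof.
move=> /ucvgP ul /ucvgP vm; apply/ucvgP => e e0.
have [N HN] := ul _ e0; have [M HM] := vm _ e0.
exists (maxn N M) => n; rewrite geq_max => /andP[Nn Mn].
by rewrite opprD addrACA absvD_lt ?HN ?HM.
Qed.

Lemma ucvgZ c u l : ucvg u l -> ucvg (fun n => c * u n) (c * l).
Proof.
move=> /ucvgP ul; have [->|c0] := eqVneq c 0.
  by apply: (ucvg_ext _ (ucvg_cst _)) => n; rewrite !mul0r.
apply/ucvgP => e e0; have c0' : 0 < absv c by rewrite absv_gt0.
have [N HN] := ul _ (divr_gt0 e0 c0'); exists N => n /HN.
by rewrite -mulrBr absvM ltr_pdivlMr // mulrC.
Qed.

Lemma ucvgN u l : ucvg u l -> ucvg (fun n => - u n) (- l).
Proof.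
by move=> /(ucvgZ (-1)); rewrite mulN1r; apply: ucvg_ext => n; rewrite mulN1r.
Qed.

Lemma ucvgB u v l m : ucvg u l -> ucvg v m -> ucvg (fun n => u n - v n) (l - m).
Proof. by move=> ul /ucvgN; exact: ucvgD. Qed.

Lemma ucvgB0 u v l : ucvg u l -> ucvg (fun n => v n - u n) 0 -> ucvg v l.
Proof.
move=> ul /ucvgD/(_ ul); rewrite add0r.
by apply: ucvg_ext => n; rewrite subrK.
Qed.

Lemma ucvg_sum (I : Type) (r : seq I) (P : pred I) (F : I -> nat -> K) (l : I -> K) :
  (forall i, P i -> ucvg (F i) (l i)) ->
  ucvg (fun n => \sum_(i <- r | P i) F i n) (\sum_(i <- r | P i) l i).
Proof.
move=> H; elim: r => [|i r IHr].
  by rewrite big_nil; apply: (ucvg_ext _ (ucvg_cst _)) => n; rewrite big_nil.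
rewrite big_cons; case: ifPn => Pi; last first.
  by apply: (ucvg_ext _ IHr) => n; rewrite big_cons (negPf Pi).
apply: (ucvg_ext _ (ucvgD (H i Pi) IHr)) => n.
by rewrite big_cons Pi.
Qed.

Lemma ucvg_bounded u l : ucvg u l -> exists2 B : R, 0 < B & exists N,
  forall n, (N <= n)%N -> absv (u n) <= B.
Proof.
move=> /ucvgP/(_ 1 ltr01)[N HN]; exists (Num.max 1 (absv l)).
  by rewrite lt_max ltr01.
exists N => n /HN H; rewrite -[u n](subrK l) absvD_le ?le_max ?lexx ?orbT //.
by rewrite (ltW H).
Qed.

Lemma ucvgM u v l m : ucvg u l -> ucvg v m -> ucvg (fun n => u n * v n) (l * m).
Proof.
move=> ul vm; have [B B0 [N HN]] := ucvg_bounded ul.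
(* The comparison sequence is [u n * m]: the difference [u n * (v n - m)] is eventually at most
   [B * absv (v n - m)]. *)
apply: (ucvgB0 (u := fun n => u n * m)).
  rewrite mulrC; move: (ucvgZ m ul).
  by apply: ucvg_ext => n; rewrite mulrC.
apply: (@ucvg_le_eventually _ _ (fun n => B * absv (v n - m)) N).
  by move=> n /HN; rewrite subr0 -mulrBr absvM => H; rewrite ler_wpM2r ?absv_ge0.
by rewrite -[X in (_ --> X)%classic](mulr0 B); apply: cvgM => //; exact: cvg_cst.
Qed.

Lemma ucvgX u l k : ucvg u l -> ucvg (fun n => u n ^+ k) (l ^+ k).
Proof.
move=> ul; elim: k => [|k IHk]; first exact: ucvg_cst.
by rewrite exprS; move: (ucvgM ul IHk); apply: ucvg_ext => n; rewrite exprS.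
Qed.

(** Otherwise [l] would be the difference of [u N] and [u N - l], both smaller than [l] for a
    suitable [N]. *)
Lemma ucvg_absv_le u l (B : R) : ucvg u l -> (forall n, absv (u n) <= B) ->
  absv l <= B.
Proof.
move=> /ucvgP ul H; rewrite leNgt; apply/negP => Bl.
have B0 : 0 <= B by apply: le_trans (H 0%N); rewrite absv_ge0.
have [N /(_ _ (leqnn _)) HN] := ul _ (le_lt_trans B0 Bl).
have : absv (u N - (u N - l)) < absv l.
  by apply: absvD_lt; rewrite ?absvN // (le_lt_trans (H N)).
by rewrite subKr ltxx.
Qed.

Lemma ucvg_comp u l (f : nat -> nat) :
  ucvg u l -> (forall N, (N <= f N)%N) -> ucvg (u \o f) l.
Proof.
move=> /ucvgP ul hf; apply/ucvgP => e /ul[N HN]; exists N => n Nn /=.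
by rewrite HN // (leq_trans Nn).
Qed.

Lemma ucvgV u l : l != 0 -> ucvg u l -> ucvg (fun n => (u n)^-1) l^-1.
Proof.
move=> l0 ul; have l0' : 0 < absv l by rewrite absv_gt0.
have /ucvgP/(_ _ l0')[N HN] := ul.
(* Near a nonzero limit the absolute value is constant, so the inverses differ by exactly
   [absv l ^- 2] times the distance of [u n] to [l]. *)
have uN n : (N <= n)%N -> absv (u n) = absv l.
  by move=> /HN H; rewrite -[u n](subrK l) addrC absvDr.
apply: (@ucvg_le_eventually _ _ (fun n => (absv l) ^- 2 * absv (u n - l)) N).
  move=> n Nn; have u0 : u n != 0 by rewrite -absv_gt0 uN.
  have -> : (u n)^-1 - l^-1 = (u n)^-1 * l^-1 * (l - u n) by field; rewrite u0 l0.
  by rewrite !absvM !absvV uN // absvB expr2 invfM.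
rewrite -[X in (_ --> X)%classic](mulr0 ((absv l) ^- 2)).
by apply: cvgM => //; exact: cvg_cst.
Qed.

End Ultrametric.

(** * The p-adic exponential and logarithm *)

(** By Legendre's formula the exponent of [p] in [n!] is the sum of the quotients [n %/ p ^ k];
    times [p - 1], this sum telescopes. *)
Lemma logn_fact_lt p n : prime p -> (0 < n)%N -> (p.-1 * logn p n`! < n)%N.
Proof.
move=> pr n0; have p1 := prime_gt1 pr.
(* The induction rests on [p * (n %/ p ^ K.+1) <= n %/ p ^ K]. *)
have telescope K : (p.-1 * (\sum_(1 <= k < K.+1) n %/ p ^ k) + n %/ p ^ K <= n)%N.
  elim: K => [|K IHK]; first by rewrite big_geq // muln0 expn0 divn1.
  rewrite big_nat_recr //= mulnDr; apply: leq_trans IHK.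
  rewrite -addnA leq_add2l -mulSnr prednK ?prime_gt0 // expnSr divnMA mulnC.
  exact: leq_divM.
have /andP[le_pn lt_np] := trunc_log_bounds p1 n0.
(* The remaining quotient is still positive here, which makes the inequality strict; all later
   quotients vanish. *)
have K0 : (0 < n %/ p ^ trunc_log p n)%N by rewrite divn_gt0 ?expn_gt0 ?prime_gt0.
have Kn : (trunc_log p n <= n)%N by rewrite (leq_trans (ltnW (ltn_expl _ p1))).
rewrite logn_fact // (@big_cat_nat _ _ _ (trunc_log p n).+1) //=.
rewrite [X in (_ + X)%N]big1_seq ?addn0.
  by rewrite (leq_trans _ (telescope (trunc_log p n))) // -addn1 leq_add2l.
move=> k /=; rewrite mem_index_iota => /andP[Kk _].
by rewrite divn_small // (leq_trans lt_np) // leq_exp2l.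
Qed.

Section Padic.
Context {R : realType} {K : ultrametricFieldType R}.
Variable p : nat.
Hypothesis p_prime : prime p.
Hypothesis absv_p : absv (p%:R : K) = p%:R^-1.

(** The estimates below use this number only through its lying strictly between 0 and 1 and its
    power of exponent [p - 1] being [1 / p]. *)
Definition exp_radius : R := p%:R `^ (- (p.-1%:R)^-1).

Implicit Types (a b c q t w x y z : K) (m n N : nat).

Let p_gt0 : (0 : R) < p%:R.
Proof. by rewrite ltr0n prime_gt0. Qed.

Lemma exp_radius_gt0 : 0 < exp_radius.
Proof. by rewrite powR_gt0. Qed.

Lemma exp_radiusX : exp_radius ^+ p.-1 = p%:R^-1.
Proof.
have p1 : (p.-1%:R : R) != 0 by rewrite pnatr_eq0 -lt0n; have := prime_gt1 p_prime; lia.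
by rewrite -powR_mulrn ?powR_ge0 // -powRrM mulNr mulVf // powR_inv1 // ltW.
Qed.

Lemma exp_radius_lt1 : exp_radius < 1.
Proof.
have p1 := prime_gt1 p_prime.
rewrite ltNge; apply/negP => /(exprn_ege1 p.-1).
by rewrite exp_radiusX leNgt invf_lt1 // ltr1n p1.
Qed.

(** Bezout: [k * m = l * p + 1]. If [m] were smaller than 1, both products would be, and hence so
    would their difference 1. *)
Lemma absv_nat_coprime m : coprime p m -> absv (m%:R : K) = 1.
Proof.
move=> pm; apply/eqP; rewrite eq_le absv_nat_le1 leNgt; apply/negP => m1.
have m0 : (0 < m)%N.
  by case: m pm m1 => // /eqP; rewrite gcdn0 => E; have := prime_gt1 p_prime; rewrite E.
have [k l E _] := egcdnP p m0.
have pl1 : absv ((l * p)%:R : K) < 1.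
  rewrite natrM absvM absv_p (le_lt_trans (_ : _ <= p%:R^-1)) //.
    by rewrite ler_piMl ?absv_nat_le1 // invr_ge0 ltW.
  by rewrite invf_lt1 // ltr1n prime_gt1.
have km1 : absv ((k * m)%:R : K) < 1.
  by rewrite natrM absvM (le_lt_trans _ m1) // ler_piMl ?absv_nat_le1 ?absv_ge0.
have : absv ((k * m)%:R - (l * p)%:R : K) < 1 by rewrite absvD_lt ?absvN.
by rewrite E gcdnC (eqP pm) natrD addrAC subrr add0r absv_1 ltxx.
Qed.

Lemma absv_nat n : (0 < n)%N -> absv (n%:R : K) = p%:R ^- logn p n.
Proof.
move=> n0; have [m pm E] := pfactor_coprime p_prime n0.
by rewrite {1}E natrM absvM natrX absvX absv_p (absv_nat_coprime pm) mul1r exprVn.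
Qed.

Lemma natr_neq0 n : (0 < n)%N -> (n%:R : K) != 0.
Proof. by move=> n0; rewrite -absv_gt0 absv_nat // invr_gt0 exprn_gt0. Qed.

Lemma absv_fact_ge n : exp_radius ^+ n <= absv (n.+1`!%:R : K).
Proof.
rewrite absv_nat ?fact_gt0 // -exprVn -exp_radiusX -exprM.
rewrite ler_wiXn2l ?(ltW exp_radius_gt0) ?(ltW exp_radius_lt1) //.
by rewrite -ltnS logn_fact_lt.
Qed.

Lemma absv_exp_term z n : absv z <= exp_radius ->
  absv (z ^+ n.+1 / n.+1`!%:R) <= absv z * (absv z / exp_radius) ^+ n.
Proof.
move=> zr; rewrite absvM absvV absvX exprS -mulrA ler_wpM2l ?absv_ge0 //.
rewrite expr_div_n ler_wpM2l ?exprn_ge0 ?absv_ge0 // lef_pV2 ?absv_fact_ge //.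
  by rewrite posrE absv_gt0 natr_neq0 ?fact_gt0.
by rewrite posrE exprn_gt0 // exp_radius_gt0.
Qed.

Lemma absv_exp_term_le z n : absv z <= exp_radius ->
  absv (z ^+ n.+1 / n.+1`!%:R) <= absv z.
Proof.
move=> zr; apply: le_trans (absv_exp_term _ zr) _.
rewrite ler_piMr ?absv_ge0 // exprn_ile1 ?divr_ge0 ?absv_ge0 ?(ltW exp_radius_gt0) //.
by rewrite ler_pdivrMr ?exp_radius_gt0 // mul1r.
Qed.

(** Geometric form of the bound: one ratio [c] common to two arguments lets the bounds multiply in
    [padic_expD]. *)
Lemma absv_exp_term_geom z n (c : R) : c <= 1 -> absv z <= exp_radius * c ->
  absv (z ^+ n / n`!%:R) <= c ^+ n.
Proof.
move=> c1 zc; have c0 : 0 <= c.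
  by rewrite -(pmulr_rge0 _ exp_radius_gt0) (le_trans (absv_ge0 z)).
have zr : absv z <= exp_radius.
  by rewrite (le_trans zc) // ler_piMr // ltW // exp_radius_gt0.
case: n => [|n]; first by rewrite !expr0 divr1 absv_1.
apply: le_trans (absv_exp_term _ zr) _; rewrite exprS.
have zc' : absv z / exp_radius <= c by rewrite ler_pdivrMr ?exp_radius_gt0 // mulrC.
apply: ler_pM; rewrite ?absv_ge0 ?exprn_ge0 ?divr_ge0 ?absv_ge0 ?(ltW exp_radius_gt0) //.
  by rewrite (le_trans zc) // ler_piMl // ltW // exp_radius_lt1.
by rewrite lerXn2r // nnegrE divr_ge0 ?absv_ge0 ?(ltW exp_radius_gt0).
Qed.

Lemma exp_radius_ratio z : absv z < exp_radius ->
  [/\ 0 <= absv z / exp_radius, absv z / exp_radius < 1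
    & absv z = exp_radius * (absv z / exp_radius)].
Proof.
move=> zr; split; first by rewrite divr_ge0 ?absv_ge0 ?(ltW exp_radius_gt0).
  by rewrite ltr_pdivrMr ?exp_radius_gt0 // mul1r.
by rewrite mulrC divfK // gt_eqF // exp_radius_gt0.
Qed.

(** * Convergence and functional equation of the exponential *)

Hypothesis complete : forall u : nat -> K, ucauchy u -> exists l, ucvg u l.

(** A finite block of the series is at most its largest term, so the partial sums are Cauchy; [ulim]
    is then a genuine limit and not its default value. *)
Lemma series_ucvg (u : nat -> K) (c : R) : 0 <= c -> c < 1 ->
  (forall n, absv (u n) <= c ^+ n) -> ucvg (series u) (ulim (series u)).
Proof.
move=> c0 c1 uc; suff : exists l, ucvg (series u) l.
  by move=> [l ul]; rewrite (ulim_ucvg ul).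
apply: complete => e e0.
have cn : (GRing.exp c @ \oo --> (0 : R))%classic.
  by apply: cvg_expr; rewrite ger0_norm.
move/cvgr0Pnorm_lt: cn => /(_ e e0)[N _ HN]; exists N.
have cN : c ^+ N < e.
  by have := HN N (leqnn N); rewrite /= ger0_norm // exprn_ge0.
have tail m n : (N <= m)%N -> (m <= n)%N -> absv (series u n - series u m) < e.
  move=> Nm mn; apply: le_lt_trans cN.
  rewrite sub_series_geq // big_nat absv_sum_le ?exprn_ge0 // => i /andP[mi _].
  by rewrite (le_trans (uc i)) // ler_wiXn2l ?(ltW c1) // (leq_trans Nm).
move=> m n Nm Nn; have [mn|/ltnW nm] := leqP m n.
  by rewrite absvB tail.
exact: tail.
Qed.

Lemma geom_cvg0 (c : R) : 0 <= c -> c < 1 -> (GRing.exp c @ \oo --> (0 : R))%classic.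
Proof. by move=> c0 c1; apply: cvg_expr; rewrite ger0_norm. Qed.

Lemma absv_pX N : absv ((p ^ N)%:R : K) = p%:R^-1 ^+ N.
Proof. by rewrite natrX absvX absv_p. Qed.

Lemma absv_pX_cvg0 : ((fun N => absv ((p ^ N)%:R : K)) @ \oo --> (0 : R))%classic.
Proof.
under eq_fun do rewrite absv_pX.
by apply: geom_cvg0; rewrite ?invr_ge0 ?(ltW p_gt0) // invf_lt1 // ltr1n prime_gt1.
Qed.

Lemma padic_exp_ucvg z : absv z < exp_radius ->
  ucvg (series (fun n => z ^+ n / n`!%:R)) (padic_exp z).
Proof.
move=> /exp_radius_ratio[c0 c1 E]; apply: (series_ucvg c0 c1) => n.
by rewrite absv_exp_term_geom -?E // ltW.
Qed.

Lemma padic_exp_sub1 z : absv z < exp_radius -> absv (padic_exp z - 1) <= absv z.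
Proof.
move=> zr; have := ucvg_comp (padic_exp_ucvg zr) leqnSn.
move=> /ucvgB/(_ (ucvg_cst 1))/ucvg_absv_le; apply=> n /=.
rewrite /series /= big_nat_recl // expr0 divr1 addrAC subrr add0r.
by apply: absv_sum_le => [|i _]; rewrite ?absv_ge0 ?absv_exp_term_le // ltW.
Qed.

(** Every term of degree at least 2 carries [c ^+ 2]. An error quadratic in [c] is what survives
    division by [c = p ^ N] in [padic_exp_limit]. *)
Lemma padic_exp_sub_linear c z : absv c <= 1 -> absv z < exp_radius ->
  absv (padic_exp (c * z) - 1 - c * z) <= absv c ^+ 2.
Proof.
move=> c1 zr; have z1 : absv z <= 1 by rewrite (le_trans (ltW zr)) ?(ltW exp_radius_lt1).
have czr : absv (c * z) < exp_radius.
  by rewrite absvM (le_lt_trans _ zr) // ler_piMl ?absv_ge0.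
(* Partial sums are taken with two extra terms, so that the constant and linear ones can always be
   split off. *)
have := ucvg_comp (padic_exp_ucvg czr) (fun n => leqW (leqnSn n)).
move=> /ucvgB/(_ (ucvg_cst 1))/ucvgB/(_ (ucvg_cst (c * z)))/ucvg_absv_le; apply=> n /=.
rewrite /series /= big_nat_recl // big_nat_recl // expr0 expr1 !divr1.
set S := \sum_(_ <= _ < _) _; have -> : 1 + (c * z + S) - 1 - c * z = S by ring.
apply: absv_sum_le => [|i _]; first by rewrite exprn_ge0 ?absv_ge0.
rewrite exprMn -mulrA absvM absvX.
rewrite -[leRHS]mulr1 ler_pM ?exprn_ge0 ?absv_ge0 //.
  by rewrite ler_wiXn2l ?absv_ge0.
by rewrite (le_trans (absv_exp_term_le _ (ltW zr))).
Qed.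

Lemma padic_exp0 : padic_exp (0 : K) = 1.
Proof.
apply/eqP; rewrite -subr_eq0 -absv_eq0 eq_le absv_ge0 andbT.
by rewrite (le_trans (padic_exp_sub1 _)) ?absv_0 ?exp_radius_gt0.
Qed.

(** The product of the partial sums for [a] and [b] is compared with the partial sum for [a + b],
    the error being at most [c ^+ n]. *)
Lemma padic_expD a b : absv a < exp_radius -> absv b < exp_radius ->
  padic_exp (a + b) = padic_exp a * padic_exp b.
Proof.
move=> ar br; have abr := absvD_lt ar br.
have [ca0 ca1 Ea] := exp_radius_ratio ar; have [cb0 cb1 Eb] := exp_radius_ratio br.
pose c := Num.max (absv a / exp_radius) (absv b / exp_radius).
have c0 : 0 <= c by rewrite le_max ca0.
have c1 : c < 1 by rewrite gt_max ca1.
have ac : absv a <= exp_radius * c.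
  by rewrite [leLHS]Ea ler_pM2l ?exp_radius_gt0 // le_max lexx.
have bc : absv b <= exp_radius * c.
  by rewrite [leLHS]Eb ler_pM2l ?exp_radius_gt0 // le_max lexx orbT.
apply/esym/(ucvg_unique (ucvgM (padic_exp_ucvg ar) (padic_exp_ucvg br))).
apply: ucvgB0 (padic_exp_ucvg abr) _.
apply: (ucvg_le (w := GRing.exp c)); last exact: geom_cvg0.
move=> n; rewrite subr0.
(* The variable only records the degree: partial sums are values at 1, and products can be sorted by
   degree. *)
pose P z : {poly K} := \poly_(i < n) (z ^+ i / i`!%:R).
have PE z : series (fun n => z ^+ n / n`!%:R) n = (P z).[1].
  by rewrite horner_poly /series /= big_mkord; apply: eq_bigr => i _; rewrite expr1n mulr1.
have coefP z i : absv z <= exp_radius * c -> absv (P z)`_i <= c ^+ i.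
  move=> zc; rewrite coef_poly; case: ifP => _; last by rewrite absv_0 exprn_ge0.
  by rewrite absv_exp_term_geom // ltW.
have sP z : (size (P z) <= n)%N by apply: size_poly.
rewrite !PE -hornerM.
have -> : (P a * P b).[1] = \sum_(0 <= i < n + n) (P a * P b)`_i.
  rewrite (@horner_coef_wide _ (n + n)); last first.
    by rewrite (leq_trans (size_polyMleq _ _)) // (leq_trans (leq_pred _)) // leq_add.
  by rewrite big_mkord; apply: eq_bigr => i _; rewrite expr1n mulr1.
rewrite (@big_cat_nat _ _ _ n) ?leq_addr //=.
rewrite -PE /series /= addrAC -sumrB big1_seq ?add0r.
  (* In degree [i >= n] each product of coefficients is at most [c ^+ i], hence at most [c ^+ n]. *)
  rewrite big_nat absv_sum_le ?exprn_ge0 // => i /andP[ni _].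
  rewrite coefM absv_sum_le ?exprn_ge0 // => j _.
  rewrite absvM (le_trans (ler_pM _ _ (coefP _ _ ac) (coefP _ _ bc))) ?absv_ge0 //.
  by rewrite -exprD subnKC -1?ltnS // ler_wiXn2l // ltW.
(* Below degree [n] truncation loses nothing, and the coefficients agree by the binomial theorem
   divided by [i!]. *)
move=> i; rewrite mem_index_iota => /andP[_ lt_in].
apply/eqP; rewrite subr_eq0 coefM addrC exprDn mulr_suml; apply/eqP/eq_bigr => j _.
have ji : (j <= i)%N by rewrite -ltnS.
rewrite !coef_poly (leq_ltn_trans ji) // (leq_ltn_trans (leq_subr _ _)) //.
rewrite -(bin_fact ji) !natrM -mulr_natr.
by field; rewrite !natr_neq0 ?fact_gt0 ?bin_gt0.
Qed.

Lemma padic_exp_natmul z n : absv z < exp_radius -> padic_exp (n%:R * z) = padic_exp z ^+ n.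
Proof.
move=> zr; elim: n => [|n IHn]; first by rewrite mul0r padic_exp0.
rewrite mulrS mulrDl mul1r padic_expD // ?exprS ?IHn //.
by rewrite absvM (le_lt_trans _ zr) // ler_piMl ?absv_ge0 ?absv_nat_le1.
Qed.

(** * The logarithm as a limit of difference quotients, and its inversion *)

Lemma absv_log_term t n : absv t < exp_radius ->
  absv ((-1) ^+ n * t ^+ n.+1 / n.+1%:R) <= absv (t ^+ n.+1 / n.+1`!%:R).
Proof.
move=> tr; rewrite !absvM (absvX (-1)) absvN absv_1 expr1n mul1r ler_wpM2l ?absv_ge0 //.
rewrite !absvV lef_pV2 ?posrE ?absv_gt0 ?natr_neq0 ?fact_gt0 //.
by rewrite factS natrM absvM ler_piMr ?absv_ge0 ?absv_nat_le1.
Qed.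

Lemma padic_log_ucvg q : absv (q - 1) < exp_radius ->
  ucvg (series (fun n => (-1) ^+ n * (q - 1) ^+ n.+1 / n.+1%:R)) (padic_log q).
Proof.
move=> qr; have [c0 c1 E] := exp_radius_ratio qr; apply: (series_ucvg c0 c1) => n.
rewrite (le_trans (absv_log_term _ qr)) //.
rewrite (le_trans (absv_exp_term_geom _ (ltW c1) _)) -?E //.
by rewrite ler_wiXn2l // ltW.
Qed.

Lemma absv_padic_log q : absv (q - 1) < exp_radius -> absv (padic_log q) <= absv (q - 1).
Proof.
move=> qr; apply: (ucvg_absv_le (padic_log_ucvg qr)) => n.
apply: absv_sum_le => [|i _]; rewrite ?absv_ge0 //.
by rewrite (le_trans (absv_log_term _ qr)) // absv_exp_term_le // ltW.
Qed.

(** This is the congruence m(m-1)...(m-n+1) = (-1)^n n! modulo m + 1. By Pascal's rule the induction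
    step adds the falling factorial of [m.+1], a multiple of [m.+1]. *)
Lemma absv_bin_sub_sign m n :
  absv (n`!%:R * ('C(m, n)%:R - (-1) ^+ n) : K) <= absv (m.+1%:R : K).
Proof.
elim: n => [|n IHn]; first by rewrite bin0 expr0 subrr mulr0 absv_0 absv_ge0.
have -> : n.+1`!%:R * ('C(m, n.+1)%:R - (-1) ^+ n.+1) =
    ('C(m.+1, n.+1) * n.+1`!)%:R - n.+1%:R * (n`!%:R * ('C(m, n)%:R - (-1) ^+ n)) :> K.
  by rewrite factS binS exprS !(natrM, natrD); ring.
apply: absvB_le.
  by rewrite bin_ffact ffactnS natrM absvM ler_piMr ?absv_ge0 ?absv_nat_le1.
by rewrite absvM (le_trans _ IHn) // ler_piMl ?absv_ge0 ?absv_nat_le1.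
Qed.

(** Term by term: 'C(m+1, i+1) / (m+1) equals 'C(m, i) / (i+1), where 'C(m, i) is close to (-1)^i by
    [absv_bin_sub_sign]. At [m.+1 = p ^ N] the error tends to 0. *)
Lemma absv_expr_sub_log q m : absv (q - 1) < exp_radius ->
  absv ((q ^+ m.+1 - 1) / m.+1%:R -
    series (fun n => (-1) ^+ n * (q - 1) ^+ n.+1 / n.+1%:R) m.+1)
  <= absv (m.+1%:R : K).
Proof.
move=> qr; set t := q - 1 in qr *.
have -> : q ^+ m.+1 - 1 = \sum_(i < m.+1) t ^+ i.+1 * 'C(m.+1, i.+1)%:R.
  rewrite -[q in LHS](subrK 1) -/t exprD1n big_ord_recl expr0 bin0 addrAC subrr add0r.
  by apply: eq_bigr => i _; rewrite mulr_natr.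
rewrite /series /= big_mkord mulr_suml -sumrB.
apply: absv_sum_le => [|i _]; first exact: absv_ge0.
have -> : t ^+ i.+1 * 'C(m.+1, i.+1)%:R / m.+1%:R - (-1) ^+ i * t ^+ i.+1 / i.+1%:R =
    t ^+ i.+1 / i.+1`!%:R * (i`!%:R * ('C(m, i)%:R - (-1) ^+ i)).
  have E : m.+1%:R * 'C(m, i)%:R = i.+1%:R * 'C(m.+1, i.+1)%:R :> K.
    by rewrite -!natrM mul_bin_diag.
  have -> : 'C(m, i)%:R = i.+1%:R * 'C(m.+1, i.+1)%:R / m.+1%:R :> K.
    by rewrite -E mulrC mulKf // natr_neq0.
  have := @natr_neq0 i.+1 isT; have := @natr_neq0 m.+1 isT.
  have := @natr_neq0 _ (fact_gt0 i); rewrite factS natrM.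
  move: (i.+1%:R : K) (m.+1%:R : K) (i`!%:R : K) => a b c c0 b0 a0.
  by field; rewrite a0 b0 c0.
rewrite absvM (le_trans _ (absv_bin_sub_sign m i)) // ler_piMl ?absv_ge0 //.
rewrite (le_trans (absv_exp_term_le _ (ltW qr))) //.
by rewrite (le_trans (ltW qr)) // ltW // exp_radius_lt1.
Qed.

Lemma ltn_pX N : (N <= p ^ N)%N.
Proof. by rewrite ltnW // ltn_expl // prime_gt1. Qed.

Lemma padic_log_limit q : absv (q - 1) < exp_radius ->
  ucvg (fun N => (q ^+ (p ^ N) - 1) / (p ^ N)%:R) (padic_log q).
Proof.
move=> qr; apply: (ucvgB0 (ucvg_comp (padic_log_ucvg qr) ltn_pX)).
apply: (ucvg_le _ absv_pX_cvg0) => N; rewrite subr0 /=.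
have : (0 < p ^ N)%N by rewrite expn_gt0 prime_gt0.
by case: (p ^ N)%N => // m _; exact: absv_expr_sub_log.
Qed.

Lemma padic_exp_limit z : absv z < exp_radius ->
  ucvg (fun N => (padic_exp z ^+ (p ^ N) - 1) / (p ^ N)%:R) z.
Proof.
move=> zr; apply: (ucvg_le _ absv_pX_cvg0) => N.
have M0 : ((p ^ N)%:R : K) != 0 by rewrite natr_neq0 // expn_gt0 prime_gt0.
have M0' : 0 < absv ((p ^ N)%:R : K) by rewrite absv_gt0.
rewrite -(ler_pM2l M0') -expr2 -absvM mulrBr mulrCA divff // mulr1.
by rewrite -padic_exp_natmul // padic_exp_sub_linear // absv_nat_le1.
Qed.

(* In the binomial expansion of (1 + h) ^ p - 1 the linear term p h dominates
   all others when |h| < exp_radius. *)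
Lemma absv_exprp_sub1 w : absv (w - 1) < exp_radius ->
  absv (w ^+ p - 1) = p%:R^-1 * absv (w - 1).
Proof.
move=> wr; set h := w - 1 in wr *; rewrite -[w in LHS](subrK 1) -/h.
have [->|h0] := eqVneq h 0; first by rewrite add0r expr1n subrr absv_0 mulr0.
have h0' : 0 < absv h by rewrite absv_gt0.
have h1 : absv h < 1 by rewrite (lt_trans wr) // exp_radius_lt1.
have p1 := prime_gt1 p_prime.
have e0 : 0 < p%:R^-1 * absv h by rewrite mulr_gt0 ?invr_gt0.
rewrite exprD1n -(big_mkord xpredT (fun i => h ^+ i *+ 'C(p, i))).
rewrite big_nat_recl // expr0 bin0 addrAC subrr add0r.
rewrite -(prednK (prime_gt0 p_prime)) big_nat_recl // prednK ?prime_gt0 //.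
rewrite expr1 bin1 -mulr_natl absvDr; first by rewrite absvM absv_p.
rewrite absvM absv_p big_nat.
elim/big_ind: _ => //; first by rewrite absv_0.
  by move=> x y; exact: absvD_lt.
move=> i /= ip; rewrite -mulr_natr absvM absvX.
(* The intermediate binomial coefficients are divisible by [p], and [absv h ^+ 2 < absv h]. *)
have [lt_ip|ge_ip] := ltnP i.+2 p.
  have /dvdnP[k ->] : (p %| 'C(p, i.+2))%N by rewrite prime_dvd_bin.
  rewrite natrM absvM absv_p mulrA mulrC ltr_pM2l ?invr_gt0 //.
  rewrite (@le_lt_trans _ _ (absv h ^+ 2)) //; last by rewrite expr2 gtr_pMr.
  rewrite -[leRHS]mulr1 ler_pM ?exprn_ge0 ?absv_ge0 ?absv_nat_le1 //.
  by rewrite ler_wiXn2l ?absv_ge0 // ltW.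
(* The top term has coefficient 1; it is small because [absv h ^+ p.-1] lies below
   [exp_radius ^+ p.-1 = 1 / p]. *)
have E : i.+2 = p by lia.
have -> : absv h ^+ i.+2 = absv h ^+ p.-1 * absv h by rewrite E -exprSr prednK ?prime_gt0.
rewrite E binn absv_1 mulr1 ltr_pM2r //.
by rewrite -exp_radiusX ltrXn2r ?absv_ge0 // -lt0n; lia.
Qed.

Lemma absv_exprpX_sub1 w N : absv (w - 1) < exp_radius ->
  absv (w ^+ (p ^ N) - 1) = absv ((p ^ N)%:R : K) * absv (w - 1).
Proof.
move=> wr; rewrite absv_pX; elim: N => [|N IHN]; first by rewrite mul1r expr1.
rewrite expnSr exprM absv_exprp_sub1; first by rewrite IHN exprS mulrA.
rewrite IHN (le_lt_trans _ wr) // ler_piMl ?absv_ge0 // -absv_pX.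
exact: absv_nat_le1.
Qed.

Lemma absv_near1 q : absv (q - 1) < exp_radius -> absv q = 1.
Proof.
move=> qr; rewrite -[q](subrK 1) addrC absvDr ?absv_1 //.
by rewrite (lt_trans qr) ?exp_radius_lt1.
Qed.

(* q and exp (log q) have the same limit of (z ^ (p ^ N) - 1) / p ^ N, and
   z |-> (z ^ (p ^ N) - 1) / p ^ N preserves the distance to 1. *)
Lemma padic_logK q : absv (q - 1) < exp_radius -> padic_exp (padic_log q) = q.
Proof.
move=> qr; have Lr := le_lt_trans (absv_padic_log qr) qr.
have q1 := absv_near1 qr; have q0 : q != 0 by rewrite -absv_gt0 q1.
set Q := padic_exp _; have Qr : absv (Q - 1) < exp_radius.
  by rewrite (le_lt_trans (padic_exp_sub1 Lr)).
have WE : absv (Q / q - 1) = absv (Q - q).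
  have -> : Q / q - 1 = (Q - q) / q by field.
  by rewrite absvM absvV q1 invr1 mulr1.
have Wr : absv (Q / q - 1) < exp_radius.
  rewrite WE; have -> : Q - q = (Q - 1) - (q - 1) by ring.
  by rewrite absvD_lt ?absvN.
apply/eqP; rewrite -subr_eq0 -absv_eq0 eq_le absv_ge0 andbT leNgt; apply/negP => e0.
(* The two quotients have the same limit, so at some [N] they differ by less than [absv (Q - q)];
   the computation below shows that they differ by exactly that. *)
have /ucvgP/(_ _ e0)[N /(_ N (leqnn N))] := ucvgB (padic_exp_limit Lr) (padic_log_limit qr).
rewrite subrr subr0 -mulrBl opprB addrA subrK absvM absvV.
have -> : Q ^+ (p ^ N) - q ^+ (p ^ N) = q ^+ (p ^ N) * ((Q / q) ^+ (p ^ N) - 1).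
  by rewrite expr_div_n; field; rewrite expf_neq0.
rewrite absvM absvX q1 expr1n mul1r absv_exprpX_sub1 // WE mulrAC divff ?mul1r ?ltxx //.
by rewrite absv_eq0 natr_neq0 // expn_gt0 prime_gt0.
Qed.

(** * Powers of [q] with exponents in the unit disc *)

Lemma qpow_arg q z : absv (q - 1) < exp_radius -> absv z <= 1 ->
  absv (z * padic_log q) < exp_radius.
Proof.
move=> qr z1; apply: (le_lt_trans _ qr).
by rewrite absvM (le_trans _ (absv_padic_log qr)) // ler_piMl ?absv_ge0.
Qed.

Lemma qpow_nat q n : absv (q - 1) < exp_radius -> qpow q n%:R = q ^+ n.
Proof.
move=> qr; rewrite /qpow padic_exp_natmul ?padic_logK //.
by rewrite (le_lt_trans (absv_padic_log qr)).
Qed.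

Lemma qpowD q x y : absv (q - 1) < exp_radius -> absv x <= 1 -> absv y <= 1 ->
  qpow q (x + y) = qpow q x * qpow q y.
Proof. by move=> qr x1 y1; rewrite /qpow mulrDl padic_expD ?qpow_arg. Qed.

Lemma qpow_natmul q x n : absv (q - 1) < exp_radius -> absv x <= 1 ->
  qpow q (n%:R * x) = qpow q x ^+ n.
Proof. by move=> qr x1; rewrite /qpow -mulrA padic_exp_natmul ?qpow_arg. Qed.

Lemma expr_pX_cvg1 q : absv (q - 1) < exp_radius -> ucvg (fun N => q ^+ (p ^ N)) 1.
Proof.
move=> qr; apply: (ucvg_le _ absv_pX_cvg0) => N.
rewrite absv_exprpX_sub1 // ler_piMr ?absv_ge0 // ltW // (lt_trans qr) //.
exact: exp_radius_lt1.
Qed.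

End Padic.

(** * Degenerate exponentials and falling factorials *)

Section FormalSeries.
Context {K : fieldType}.
Implicit Types (f g : nat -> K) (P : {poly K}) (lambda z : K).

(** Coefficients up to degree [m] see only the truncation at [m], so power series can be handled as
    polynomials. *)
Lemma fps_pow_coef f k m n : (n <= m)%N ->
  fps_pow f k n = ((\poly_(i < m.+1) f i) ^+ k)`_n.
Proof.
elim: k n => [|k IHk] n nm; first by rewrite expr0 coef1.
rewrite exprS coefM; apply: eq_bigr => i _.
have im : (i <= m)%N by rewrite (leq_trans _ nm) // -ltnS.
by rewrite coef_poly ltnS im -IHk // (leq_trans (leq_subr _ _)).
Qed.

Lemma coef_exp_small P k n : P`_0 = 0 -> (n < k)%N -> (P ^+ k)`_n = 0.
Proof.
rewrite -horner_coef0 => /eqP/factor_theorem[Q ->] nk.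
by rewrite polyC0 subr0 exprMn coefMXn nk.
Qed.

(** The terms with [k > n] vanish since [g] has no constant term. A bound [m] independent of [n]
    lets one polynomial serve two consecutive coefficients. *)
Lemma fps_comp_coef f g m n : g 0%N = 0 -> (n <= m)%N ->
  fps_comp f g n = (\sum_(k < m.+1) f k *: (\poly_(i < m.+1) g i) ^+ k)`_n.
Proof.
move=> g0 nm; rewrite coef_sum /fps_comp.
rewrite (big_ord_widen m.+1 (fun k => f k * fps_pow g k n)) ?ltnS //.
rewrite [RHS](bigID (fun k : 'I__ => (k < n.+1)%N)) /= [X in _ + X]big1 ?addr0.
  by apply: eq_bigr => k _; rewrite coefZ (fps_pow_coef _ _ nm).
by move=> k; rewrite -leqNgt => nk; rewrite coefZ coef_exp_small ?mulr0 // coef_poly.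
Qed.

(** The polynomial defining the Stirling numbers is evaluated at [z / lambda] and scaled by
    [lambda ^+ n]. *)
Lemma degenerate_ffact_stirling1 lambda z n : lambda != 0 ->
  degenerate_ffact lambda z n =
  \sum_(l < n.+1) (stirling1 n l)%:~R * lambda ^+ (n - l) * z ^+ l.
Proof.
move=> l0; rewrite /stirling1.
set P : {poly int} := \prod_(i < n) _.
have sP : size P = n.+1 by rewrite size_prod_XsubC /index_enum -enumT size_enum_ord.
have -> : degenerate_ffact lambda z n = lambda ^+ n * (map_poly intr P).[z / lambda].
  rewrite rmorph_prod horner_prod -[n in lambda ^+ n]card_ord -prodr_const -big_split /=.
  apply: eq_bigr => i _; rewrite map_polyXsubC hornerXsubC /= rmorph_nat.
  by field.
rewrite (@horner_coef_wide _ n.+1) -?sP ?size_poly // sP mulr_sumr.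
apply: eq_bigr => i _; rewrite coef_map /= mulrCA -mulrA; congr (_ * _).
have i_n : (i <= n)%N by rewrite -ltnS.
rewrite expr_div_n -{1}(subnK i_n) exprD; field.
by rewrite expf_neq0.
Qed.

Lemma degenerate_ffactS lambda z n :
  degenerate_ffact lambda z n.+1 = degenerate_ffact lambda z n * (z - n%:R * lambda).
Proof. by rewrite /degenerate_ffact big_ord_recr. Qed.

Lemma degenerate_ffactD lambda z w n :
  degenerate_ffact lambda (z + w) n =
  \sum_(k < n.+1) 'C(n, k)%:R * degenerate_ffact lambda z (n - k)
                  * degenerate_ffact lambda w k.
Proof.
pose d := degenerate_ffact lambda.
elim: n => [|n IHn].
  by rewrite big_ord1 /degenerate_ffact !big_ord0 bin0 !mulr1.
rewrite degenerate_ffactS IHn big_distrl /=.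
(* The new factor splits as [(z - (n - k) lambda) + (w - k lambda)], one part prolonging each
   falling factorial; Pascal's rule then recombines the sums. *)
have step k : (k <= n)%N ->
    'C(n, k)%:R * d z (n - k)%N * d w k * (z + w - n%:R * lambda) =
    'C(n, k)%:R * d z (n.+1 - k)%N * d w k + 'C(n, k)%:R * d z (n - k)%N * d w k.+1.
  move=> kn; rewrite subSn // /d !degenerate_ffactS.
  have -> : n%:R = (n - k)%:R + k%:R :> K by rewrite -natrD subnK.
  by ring.
under eq_bigr => k _ do rewrite step -1?ltnS //.
rewrite big_split /= [in LHS]big_ord_recl [in RHS]big_ord_recl /= !bin0 -addrA.
congr (_ + _).
under [in RHS]eq_bigr => k _.
  rewrite /bump add1n binS natrD !mulrDl subSS; over.
rewrite big_split /= [X in _ = X + _]big_ord_recr /= bin_small // !mul0r addr0.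
by congr (_ + _); apply: eq_bigr => k _; rewrite /bump add1n subSS.
Qed.

Hypothesis char0 : forall n, (n.+1%:R : K) != 0.

Lemma natr_fact_neq0 n : (n`!%:R : K) != 0.
Proof. by have := fact_gt0 n; case: n`! => // m _; exact: char0. Qed.

(* The coefficient of t ^ n in (1 + lambda t) F' = z F, satisfied by
   F = (1 + lambda t) ^ (z / lambda); F is replaced by a polynomial which has
   the same coefficients up to degree n + 1. *)
Lemma degenerate_exp_rec lambda z n : lambda != 0 ->
  n.+1%:R * degenerate_exp lambda z n.+1 =
  (z - n%:R * lambda) * degenerate_exp lambda z n.
Proof.
move=> l0; rewrite /degenerate_exp; set g := fun n => _.
have g0 : g 0%N = 0 by rewrite /g mulr0.
rewrite !(fps_comp_coef _ (m := n.+1)) //.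
set G := \poly_(i < n.+2) g i; set F := \sum_(k < n.+2) _.
(* Up to degree [n] this is [(1 + lambda t) G' = z], the equation of the logarithm. *)
have GS j : (j < n.+1)%N -> G^`()`_j + lambda * (j%:R * G`_j) = z *+ (j == 0%N).
  move=> jn; have -> : G^`()`_j = j.+1%:R * G`_j.+1 by rewrite coef_deriv mulr_natl.
  rewrite !coef_poly ltnS jn ltnS (ltnW jn) /g /=.
  case: j jn => [|j] jn.
    by rewrite -[RHS]/z /= mul0r mulr0 addr0 expr0 expr1 invr1 !mul1r mulr1 divfK.
  rewrite -[RHS]/(0 : K) /=.
  have := char0 j.+1; have := char0 j.
  move: (j.+1%:R : K) (j.+2%:R : K) => a b a0 b0.
  by rewrite !exprS; field; rewrite a0 b0 l0.
(* Differentiating the truncated exponential drops its top term. That term starts in degree [n.+1],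
   so it does not affect coefficient [n]. *)
have dF : F^`() = G^`() * (F - fps_exp n.+1 *: G ^+ n.+1).
  rewrite {2}/F big_ord_recr /= addrK mulr_sumr /F big_ord_recl derivD raddf_sum.
  rewrite derivZ expr0 derivC scaler0 add0r; apply: eq_bigr => k _.
  rewrite lift0 /= derivZ deriv_exp -scaler_nat scalerA -scalerAr.
  by rewrite /fps_exp factS natrM invfM mulrAC mulVf // mul1r.
have : (F^`() * (1 + lambda *: 'X))`_n = z * F`_n.
  rewrite dF mulrAC coefM big_ord_recl /= subn0 [X in _ + X]big1 ?addr0.
    rewrite mulrDr mulr1 coefD -scalerAr coefZ coefMX /= mulr0 addr0.
    have /= := GS 0%N isT; rewrite mul0r mulr0 addr0 mulr1n => ->.
    by rewrite coefB coefZ coef_exp_small ?mulr0 ?subr0 // coef_poly.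
  move=> j _; rewrite mulrDr mulr1 coefD -scalerAr coefZ coefMX /bump add1n /=.
  have := GS j.+1 (ltn_ord j); rewrite [G^`()`_j]coef_deriv mulr_natl => ->.
  by rewrite mul0r.
rewrite mulrDr mulr1 coefD -scalerAr coefZ coefMX !coef_deriv => E.
by rewrite mulrBl -E; case: (n) => [|m] /=; ring.
Qed.

Lemma degenerate_exp_ffact lambda z n : lambda != 0 ->
  n`!%:R * degenerate_exp lambda z n = degenerate_ffact lambda z n.
Proof.
move=> l0; elim: n => [|n IHn].
  rewrite /degenerate_exp /fps_comp big_ord1 /degenerate_ffact big_ord0.
  by rewrite /fps_exp invr1 !mul1r.
rewrite factS mulnC natrM -mulrA degenerate_exp_rec //.
by rewrite mulrCA IHn degenerate_ffactS mulrC.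
Qed.

End FormalSeries.

(** * Fermionic moments of [y]_q *)

Lemma umbral_wide (R : realType) (K : ultrametricFieldType R) (E : nat -> K)
    (P : {poly K}) m :
  (size P <= m)%N -> umbral E P = \sum_(k < m) P`_k * E k.
Proof.
move=> Pm; rewrite /umbral (big_ord_widen m (fun k => P`_k * E k) Pm) big_mkcond.
apply: eq_bigr => k _; case: ltnP => // kP.
by rewrite nth_default // mul0r.
Qed.

Lemma umbral_affine_exp (R : realType) (K : ultrametricFieldType R) (E : nat -> K) q n :
  umbral E ((q *: 'X + 1) ^+ n) = \sum_(k < n.+1) 'C(n, k)%:R * q ^+ k * E k.
Proof.
have -> : (q *: 'X + 1) ^+ n = \poly_(k < n.+1) ('C(n, k)%:R * q ^+ k).
  rewrite exprD1n poly_def; apply: eq_bigr => k _.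
  by rewrite exprZn scalerMnl mulr_natl.
rewrite (umbral_wide _ (size_poly _ _)); apply: eq_bigr => k _.
by rewrite coef_poly ltn_ord.
Qed.

Section FermionicIntegral.
Context {R : realType} {K : ultrametricFieldType R} {p : nat}.
Hypotheses (p_prime : prime p) (p_odd : odd p).
Hypothesis absv_p : absv (p%:R : K) = p%:R^-1.
Hypothesis complete : forall u : nat -> K, ucauchy u -> exists l, ucvg u l.
Variable q : K.
Hypotheses (q_near1 : absv (q - 1) < exp_radius p) (q_neq1 : q != 1).

Definition fermionic_sum (g : nat -> K) (N : nat) : K :=
  (qnum_neg q (p ^ N))^-1 * \sum_(0 <= y < p ^ N) g y * (- q) ^+ y.

(** This is [y]_q with an ordinary power of [q], so that its recursion is pure algebra; [qpow_nat]
    links it to [qnum]. *)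
Definition qint (y : nat) : K := (1 - q ^+ y) / (1 - q).

Lemma subr1q_neq0 : 1 - q != 0.
Proof. by rewrite subr_eq0 eq_sym. Qed.

Lemma qint0 : qint 0 = 0.
Proof. by rewrite /qint subrr mul0r. Qed.

Lemma qintS y : qint y.+1 = q * qint y + 1.
Proof. by rewrite /qint exprS; field; rewrite subr1q_neq0. Qed.

Lemma absv_expr_sub1_le n : absv (q ^+ n - 1) <= absv (q - 1).
Proof.
elim: n => [|n IHn]; first by rewrite subrr absv_0 absv_ge0.
have -> : q ^+ n.+1 - 1 = q * (q ^+ n - 1) + (q - 1) by rewrite exprS; ring.
by rewrite absvD_le // absvM (absv_near1 p_prime q_near1) mul1r.
Qed.

(** As [p] is odd, 2 has absolute value 1, and [q ^+ n - 1] is too small to change it. The cases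
    [n = 0] and [n = 1] give the denominators 2 and [1 + q]. *)
Lemma addr1_expr_neq0 n : 1 + q ^+ n != 0.
Proof.
have abs2 : absv (2%:R : K) = 1.
  by apply: (absv_nat_coprime p_prime absv_p); rewrite coprimen2.
have -> : 1 + q ^+ n = 2%:R + (q ^+ n - 1) by ring.
rewrite -absv_gt0 absvDr abs2 // (le_lt_trans (absv_expr_sub1_le n)) //.
by rewrite (lt_trans q_near1) ?exp_radius_lt1.
Qed.

Lemma fermionic_sumZ c g N :
  fermionic_sum (fun y => c * g y) N = c * fermionic_sum g N.
Proof.
rewrite /fermionic_sum mulrCA [X in _ = _ * X]mulr_sumr; congr (_ * _).
by apply: eq_bigr => y _; rewrite mulrA.
Qed.

Lemma fermionic_sum_sum n (g : 'I_n -> nat -> K) N :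
  fermionic_sum (fun y => \sum_(i < n) g i y) N = \sum_(i < n) fermionic_sum (g i) N.
Proof.
rewrite /fermionic_sum -mulr_sumr exchange_big /=; congr (_ * _).
by apply: eq_bigr => y _; rewrite mulr_suml.
Qed.

Lemma fermionic_sum_shift g N :
  q * fermionic_sum (fun y => g y.+1) N + fermionic_sum g N =
  (1 + q) / (1 + q ^+ (p ^ N)) * (g 0%N + q ^+ (p ^ N) * g (p ^ N)%N).
Proof.
have neg_exp : (- q) ^+ (p ^ N) = - q ^+ (p ^ N).
  by rewrite exprNn -signr_odd oddX p_odd orbT mulN1r.
have q1 : 1 + q != 0 by have := addr1_expr_neq0 1; rewrite expr1.
have -> : (1 + q) / (1 + q ^+ (p ^ N)) = (qnum_neg q (p ^ N))^-1.
  by rewrite /qnum_neg neg_exp opprK invf_div.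
rewrite /fermionic_sum mulrCA -mulrDr; congr (_ * _).
rewrite mulr_sumr -big_split /=.
(* The factor [q] turns [(- q) ^+ y] into [- (- q) ^+ y.+1], so each summand is minus a difference
   of consecutive values of [F]. *)
pose F y := g y * (- q) ^+ y.
rewrite (eq_bigr (fun y => - (F y.+1 - F y))); last first.
  by move=> y _; rewrite /F exprS; ring.
rewrite sumrN telescope_sumr // opprB /F neg_exp expr0; ring.
Qed.

(** Carlitz's recursion before the limit, with its boundary term. The top binomial term, with
    coefficient [q * q ^+ n.+1], has moved to the left. *)
Lemma fermionic_sum_qint_rec n N :
  (1 + q ^+ n.+2) * fermionic_sum (fun y => qint y ^+ n.+1) N =
  (1 + q) / (1 + q ^+ (p ^ N)) * (q ^+ (p ^ N) * qint (p ^ N) ^+ n.+1) -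
  q * \sum_(k < n.+1) 'C(n.+1, k)%:R * q ^+ k * fermionic_sum (fun y => qint y ^+ k) N.
Proof.
have := fermionic_sum_shift (fun y => qint y ^+ n.+1) N.
rewrite /= qint0 expr0n mulr0n add0r => <-.
have -> : (fun y => qint y.+1 ^+ n.+1) =
    (fun y => \sum_(k < n.+2) 'C(n.+1, k)%:R * q ^+ k * qint y ^+ k).
  apply/funext => y; rewrite qintS exprD1n; apply: eq_bigr => k _.
  by rewrite exprMn -mulr_natl mulrA.
rewrite fermionic_sum_sum big_ord_recr /= binn mul1r fermionic_sumZ.
under eq_bigr => k _ do rewrite fermionic_sumZ.
rewrite exprS; ring.
Qed.

Lemma qint_pX_cvg0 : ucvg (fun N => qint (p ^ N)) 0.
Proof.
have := ucvgB (ucvg_cst 1) (expr_pX_cvg1 p_prime absv_p q_near1).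
move/(ucvgZ (1 - q)^-1); rewrite subrr mulr0.
by apply: ucvg_ext => N; rewrite mulrC.
Qed.

Lemma fermionic_sum_carlitz E n : carlitz_qEuler q E ->
  ucvg (fermionic_sum (fun y => qint y ^+ n)) (E n).
Proof.
move=> [E0 ES]; elim/ltn_ind: n => -[|n] IHn.
  (* The Riemann sum of 1 is exactly 1 at every level, by the shift identity for a constant
     function. *)
  rewrite E0; apply: (ucvg_ext _ (ucvg_cst 1)) => N.
  have q1 : 1 + q != 0 by have := addr1_expr_neq0 1; rewrite expr1.
  apply: (mulfI q1); have /= := fermionic_sum_shift (fun=> 1) N.
  rewrite mulr1 divfK ?addr1_expr_neq0 // => shift1.
  by rewrite mulr1 -[LHS]shift1 mulrDl mul1r addrC.
have b0 := addr1_expr_neq0 n.+2.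
(* Carlitz's recursion is solved for [E n.+1] with the vanishing boundary term left unsimplified, to
   match the limit of [fermionic_sum_qint_rec] factor by factor. *)
have -> : E n.+1 = (1 + q ^+ n.+2)^-1 * ((1 + q) / (1 + 1) * (1 * 0 ^+ n.+1) -
    q * \sum_(k < n.+1) 'C(n.+1, k)%:R * q ^+ k * E k).
  apply: (mulfI b0); rewrite mulVKf // expr0n !mulr0 sub0r.
  have /eqP := ES n.+1 isT; rewrite umbral_affine_exp big_ord_recr /= binn mul1r.
  rewrite -subr_eq0 subr0 => /eqP e0; apply/eqP; rewrite -subr_eq0 -[X in _ == X]e0.
  by apply/eqP; rewrite exprS; ring.
have pX1 := expr_pX_cvg1 p_prime absv_p q_near1.
have two0 : 1 + 1 != 0 :> K by have := addr1_expr_neq0 0; rewrite expr0.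
have head := ucvgM (ucvgZ (1 + q) (ucvgV two0 (ucvgD (ucvg_cst 1) pX1)))
  (ucvgM pX1 (ucvgX n.+1 qint_pX_cvg0)).
have tail : ucvg (fun N => q * \sum_(k < n.+1) 'C(n.+1, k)%:R * q ^+ k *
    fermionic_sum (fun y => qint y ^+ k) N)
    (q * \sum_(k < n.+1) 'C(n.+1, k)%:R * q ^+ k * E k).
  by apply/ucvgZ/ucvg_sum => k _; apply/ucvgZ/IHn.
have := ucvgZ (1 + q ^+ n.+2)^-1 (ucvgB head tail).
by apply: ucvg_ext => N; rewrite -fermionic_sum_qint_rec mulKf.
Qed.

Lemma qnum_addn x y : absv x <= 1 ->
  qnum q (x + y%:R) = qnum q x + qpow q x * qint y.
Proof.
move=> x1; rewrite /qnum (qpowD p_prime absv_p) ?absv_nat_le1 //.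
rewrite (qpow_nat p_prime absv_p) // /qint.
by field; rewrite subr1q_neq0.
Qed.

End FermionicIntegral.

Theorem theorem2p5 (R : realType) (p : nat) (Cp : ultrametricFieldType R)
    (p_prime : prime p) (p_odd : odd p) (CpP : is_Cp p Cp)
    (q lambda x : Cp)
    (q_neq1 : q != 1) (q_near1 : absv (q - 1) < p%:R `^ (- (p.-1%:R)^-1))
    (lambda_neq0 : lambda != 0) (x_le1 : absv x <= 1)
    (E : nat -> Cp) (EP : carlitz_qEuler q E) (n : nat) :
  degenerate_qEuler p q lambda n x =
  \sum_(k < n.+1) \sum_(l < k.+1)
    'C(n, k)%:R * degenerate_ffact lambda (qnum q x) (n - k)
    * lambda ^+ (k - l) * qpow q (l%:R * x) * (stirling1 k l)%:~R * E l.
Proof.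
have complete := Cp_complete CpP; have absv_p := Cp_absv_p CpP.
have char0 m : (m.+1%:R : Cp) != 0 by apply: natr_neq0 p_prime absv_p _ _.
pose c k l := 'C(n, k)%:R * degenerate_ffact lambda (qnum q x) (n - k)
    * lambda ^+ (k - l) * qpow q (l%:R * x) * (stirling1 k l)%:~R.
(* The integrand is a finite combination of powers of [y]_q with coefficients independent of [y], so
   linearity reduces the integral to moments. *)
have integrandE : (fun y : nat => degenerate_exp lambda (qnum q (x + y%:R)) n) =
    (fun y => n`!%:R^-1 * \sum_(k < n.+1) \sum_(l < k.+1) c k l * qint q y ^+ l).
  apply/funext => y; apply: (mulfI (natr_fact_neq0 char0 n)).
  rewrite mulVKf ?natr_fact_neq0 // degenerate_exp_ffact //.
  rewrite (qnum_addn p_prime absv_p) // degenerate_ffactD.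
  apply: eq_bigr => k _.
  rewrite [degenerate_ffact _ (qpow q x * _) _]degenerate_ffact_stirling1 // mulr_sumr.
  apply: eq_bigr => l _; rewrite /c (qpow_natmul p_prime absv_p) // exprMn; ring.
rewrite /degenerate_qEuler /fermionic_integral.
have -> : (fun N => (qnum_neg q (p ^ N))^-1 * \sum_(0 <= y < p ^ N)
      degenerate_exp lambda (qnum q (x + y%:R)) n * (- q) ^+ y) =
    (fun N => n`!%:R^-1 * \sum_(k < n.+1) \sum_(l < k.+1)
      c k l * fermionic_sum (p := p) q (fun y => qint q y ^+ l) N).
  apply/funext => N; rewrite -[LHS]/(fermionic_sum q
    (fun y : nat => degenerate_exp lambda (qnum q (x + y%:R)) n) N).
  rewrite integrandE fermionic_sumZ fermionic_sum_sum; congr (_ * _).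
  apply: eq_bigr => k _; rewrite fermionic_sum_sum.
  by apply: eq_bigr => l _; rewrite fermionic_sumZ.
(* Exhibiting the limit removes the default value of [ulim]; the factor [n!] then cancels. *)
rewrite (ulim_ucvg (l := n`!%:R^-1 * \sum_(k < n.+1) \sum_(l < k.+1) c k l * E l)).
  by rewrite mulVKf ?natr_fact_neq0.
apply/ucvgZ/ucvg_sum => k _; apply/ucvg_sum => l _; apply: ucvgZ.
exact: fermionic_sum_carlitz.
Qed.
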